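(* Let $G$ and $H$ be graphs, and let $A\in\mathcal{S}(G)$ and $B\in\mathcal{S}(H)$ have the SSP. Suppose that $A$ and $B$ have exactly one distinct eigenvalue in common, $\operatorname{spec}(A)\cap\operatorname{spec}(B)=\{\lambda\}$, with $\operatorname{mult}_A(\lambda)=k$ and $\operatorname{mult}_B(\lambda)=1$, and that $\ker(A-\lambda I)$ and $\ker(B-\lambda I)$ are generic. Let $\beta\subseteq V(G)\times V(H)$. If either - $|\beta\cap(\{u\}\times V(H))|=2$ for $k$ distinct $u\in V(G)$, or - $|\beta\cap(V(G)\times\{v\})|=k+1$ for some $v\in V(H)$, then $\beta$ is an SSP liberation set of $A\oplus B$ (viewed as a matrix in $\mathcal{S}(G\,\dot\cup\,H)$). In particular, there is a matrix $C\in\mathcal{S}((G\,\dot\cup\,H)+\beta)$ with the SSP such that $\operatorname{spec}(C)=\operatorname{spec}(A)\cup\operatorname{spec}(B)$ (union as multisets). Moreover, when $k=1$, any $\beta\subseteq V(G)\times V(H)$ with $|\beta|=2$ is an SSP liberation set of $A\oplus B$.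
   Context: All graphs are finite and simple. For a graph $G$ on $n$ vertices, $\mathcal{S}(G)$ is the set of real symmetric $n\times n$ matrices (rows and columns indexed by $V(G)$) whose $(i,j)$-entry, $i\ne j$, is nonzero if and only if $\{i,j\}\in E(G)$; diagonal entries are unconstrained. $\overline{G}$ is the complement of $G$. For $\beta\subseteq E(\overline{G})$, $G+\beta$ is the graph with vertex set $V(G)$ and edge set $E(G)\cup\beta$. $G\,\dot\cup\,H$ is the disjoint union of graphs; a pair $(u,v)\in V(G)\times V(H)$ is identified with the nonedge $\{u,v\}$ of $G\,\dot\cup\,H$. $\mathcal{S}_0^{\rm cl}(G)$ is the set of real symmetric matrices with zero diagonal whose $(i,j)$-entry is nonzero only if $\{i,j\}\in E(G)$. $\operatorname{spec}(A)$ is the multiset of eigenvalues of $A$, and $\operatorname{mult}_A(\lambda)$ is the multiplicity of the eigenvalue $\lambda$. $[A,X]=AX-XA$, and $O$ is the zero matrix. For a spanning subgraph $G$ of $H$ and $A\in\mathcal{S}(G)$, $A$ has the SSP with respect to $H$ if $X=O$ is the only symmetric matrix with $X\in\mathcal{S}_0^{\rm cl}(\overline{H})$ and $[A,X]=O$. $A\in\mathcal{S}(G)$ has the SSP (strong spectral property) if it has it with respect to $G$ itself. A nonempty set $\beta\subseteq E(\overline{G})$ is an SSP liberation set of $A\in\mathcal{S}(G)$ if $A$ has the SSP with respect to $G+\beta'$ for all $\beta'\subset\beta$ with $|\beta'|=|\beta|-1$. A $d$-dimensional subspace $\mathcal{W}$ of $\mathbb{R}^n$ is generic if, for an $n\times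 d$ matrix $W$ whose columns form a basis of $\mathcal{W}$, every $d\times d$ submatrix of $W$ is invertible (this does not depend on the choice of $W$). *)

(* Defs.v *)
From mathcomp Require Import all_boot all_order all_algebra.
From mathcomp Require Import reals.

Set Implicit Arguments.
Unset Strict Implicit.
Unset Printing Implicit Defensive.

Import GRing.Theory.
Local Open Scope ring_scope.

Section Graphs.
Variable n : nat.

Definition vpairs : {set {set 'I_n}} := [set e : {set 'I_n} | #|e| == 2].

Record sgraph := SGraph {
  edges : {set {set 'I_n}};
  edges_vpairs : edges \subset vpairs }.

Definition compl (G : sgraph) : sgraph :=
  SGraph (subsetDl vpairs (edges G)).

Lemma add_edges_subproof (G : sgraph) (beta : {set {set 'I_n}}) :
  edges G :|: beta :&: edges (compl G) \subset vpairs.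
Proof.
rewrite subUset edges_vpairs /=.
exact: subset_trans (subsetIr _ _) (subsetDl _ _).
Qed.

(* The intersection only makes the operation total: the graph is G + beta
   whenever beta is a set of nonedges of G. *)
Definition add_edges (G : sgraph) (beta : {set {set 'I_n}}) : sgraph :=
  SGraph (add_edges_subproof G beta).

End Graphs.

Section DisjointUnion.
Variables m n : nat.

Lemma disj_union_subproof (G : sgraph m) (H : sgraph n) :
  [set lshift n @: e | e : {set 'I_m} in edges G]
    :|: [set @rshift m n @: e | e : {set 'I_n} in edges H] \subset vpairs (m + n).
Proof.
apply/subsetP => f; rewrite inE => /orP[] /imsetP[e eE ->]; rewrite inE.
- rewrite card_imset; last exact: lshift_inj.
  by move: (subsetP (edges_vpairs G) e eE); rewrite inE.
- rewrite card_imset; last exact: rshift_inj.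
  by move: (subsetP (edges_vpairs H) e eE); rewrite inE.
Qed.

Definition disj_union (G : sgraph m) (H : sgraph n) : sgraph (m + n) :=
  SGraph (disj_union_subproof G H).

(* (u, v) in V(G) x V(H), as a nonedge of the disjoint union. *)
Definition cross_pairs (beta : {set 'I_m * 'I_n}) : {set {set 'I_(m + n)}} :=
  [set [set lshift n p.1; rshift m p.2] | p in beta].

End DisjointUnion.

Section Matrices.
Variable R : realType.

Definition inS n (G : sgraph n) (A : 'M[R]_n) : Prop :=
  A^T = A /\
  forall i j : 'I_n, i != j -> (A i j != 0) = ([set i; j] \in edges G).

Definition inS0cl n (G : sgraph n) (X : 'M[R]_n) : Prop :=
  [/\ X^T = X,
      forall i : 'I_n, X i i = 0
    & forall i j : 'I_n, X i j != 0 -> [set i; j] \in edges G].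

Definition commutator n (A X : 'M[R]_n) : 'M[R]_n := A *m X - X *m A.

Definition SSP_wrt n (H : sgraph n) (A : 'M[R]_n) : Prop :=
  forall X : 'M[R]_n, inS0cl (compl H) X -> commutator A X = 0 -> X = 0.

Definition SSP n (G : sgraph n) (A : 'M[R]_n) : Prop :=
  inS G A /\ SSP_wrt G A.

Definition SSP_liberation n (G : sgraph n) (A : 'M[R]_n)
    (beta : {set {set 'I_n}}) : Prop :=
  [/\ inS G A,
      beta != set0,
      beta \subset edges (compl G)
    & forall beta' : {set {set 'I_n}},
        beta' \subset beta -> #|beta'| = #|beta|.-1 ->
        SSP_wrt (add_edges G beta') A].

(* The multiset spec(A), given by its multiplicity function: spec A mu is
   mult_A(mu), and the union of multisets is pointwise addition. *)
Definition spec n (A : 'M[R]_n) : R -> nat := fun mu => mup mu (char_poly A).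

(* ker A as a space of column vectors (kermx A is the left kernel). *)
Definition ker_col n (A : 'M[R]_n) : {vspace 'cV[R]_n} :=
  lker (linfun (mulmx A : 'cV[R]_n -> 'cV[R]_n)).

Definition generic n (V : {vspace 'cV[R]_n}) : Prop :=
  exists W : 'M[R]_(n, \dim V),
    basis_of V [seq col j W | j : 'I_(\dim V)] /\
    forall f : 'I_(\dim V) -> 'I_n, injective f -> rowsub f W \in unitmx.

Definition direct_sum m n (A : 'M[R]_m) (B : 'M[R]_n) : 'M[R]_(m + n) :=
  block_mx A 0 0 B.

End Matrices.

(* Main.v *)
From HB Require Import structures.
Require Import Defs.
From mathcomp Require Import boolp classical_sets functions.
From mathcomp Require Import interval_inference topology normedtype sequences.
From mathcomp Require Import all_boot all_order all_algebra.
From mathcomp Require Import reals complex ring lra.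

Set Implicit Arguments.
Unset Strict Implicit.
Unset Printing Implicit Defensive.

Import Order.TTheory GRing.Theory Num.Theory.
Import numFieldNormedType.Exports.
Local Open Scope ring_scope.

(** Put M = A (+) B and let X be a symmetric matrix, zero on the diagonal and
    on the edges of the disjoint union, with [M, X] = O.  The diagonal blocks
    of X vanish by the SSP of A and of B, and the off-diagonal block Y
    satisfies AY = YB.  Both spectra are real and meet only in lam, a simple
    root of the characteristic polynomial of B, so Bezout and Cayley-Hamilton
    give (A - lam I)Y = O = Y(B - lam I) (symmetric_intertwine): the columns of
    Y lie in ker(A - lam I) and its rows in ker(B - lam I).  The second kernel
    is spanned by a vector without zero entries, so one zero in a row of Y
    kills that row; the first is generic of dimension at most k, so k zero
    rows kill Y (generic_eq0).  Hence beta is a liberation set as soon as, for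
    every p in beta, the pairs of beta other than p still meet k rows
    (direct_sum_liberation), and each of the three hypotheses on beta ensures
    this by counting.

    The matrix C comes from the general fact that a liberation set beta of M
    can be added to the graph without changing the spectrum
    (liberation_isospectral).  For M with the SSP with respect to H, the map
    X |-> P(X) + [M, [M, X]], where P keeps the diagonal and the edges of H,
    is definite on symmetric matrices (ssp_operator_eq0), hence onto: every
    symmetric matrix is the sum of one supported on H and of a bracket [M, K]
    with K skew.  Used with H = G + (beta minus e) for each e in beta, this
    yields brackets [M, K] supported on G + beta with a nonzero e-entry, and a
    generic combination has all its beta-entries nonzero
    (liberation_direction).  To move along this direction at constant
    spectrum, the Cayley transform of a skew K is used in its polynomial form
    (I - K) M (I + K) = (I + K)(M + E)(I - K), which says
    E = 2[M, K] + [E, K] + KEK.  The last two terms are of second order, so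
    starting from t(2[M, K0], K0) a solution is reached by correcting them
    with a right inverse of the operator above, through a contraction
    (perturbed_fixed_point).  The correction is small compared with t, so the
    beta-entries of E stay nonzero; the SSP is an open condition
    (SSP_wrt_open), so M + E has it. *)

(** * Symmetric matrices intertwined by a rectangular one *)

(** Comparing v A v* with its conjugate transpose, for a complex row
    eigenvector v of eigenvalue z, gives z |v|^2 = conj(z) |v|^2. *)
Lemma symmetric_char_poly_root_real (R : rcfType) n (A : 'M[R]_n) (z : R[i]) :
  A^T = A -> root (map_poly (real_complex R) (char_poly A)) z ->
  exists2 x, z = (x%:C)%C & root (char_poly A) x.
Proof.
move=> Asym; rewrite map_char_poly -eigenvalue_root_char => /eigenvalueP[v vA v0].
set A' := map_mx _ A in vA.
have A'sym : (map_mx conjc A')^T = A'.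
  by apply/matrixP => i j; rewrite !mxE conjc_real -[in LHS]Asym mxE.
pose w := (map_mx conjc v)^T.
have wN : v *m w != 0.
  apply: contra_neq v0 => /matrixP/(_ ord0 ord0); rewrite !mxE => /eqP.
  rewrite psumr_eq0 => [/allP vi|i _]; last by rewrite !mxE mulcJ_ge0.
  apply/rowP => i; have := vi i; rewrite mem_index_enum !mxE => /(_ isT)/=.
  by rewrite -sqr_normc sqrf_eq0 normr_eq0 => /eqP.
have wA : A' *m w = (z^*)%C *: w.
  have : (map_mx conjc (v *m A'))^T = (map_mx conjc (z *: v))^T by rewrite vA.
  rewrite map_mxM trmx_mul A'sym -/w => ->.
  by apply/matrixP => i j; rewrite !mxE rmorphM.
have : z *: (v *m w) = (z^*)%C *: (v *m w).
  by rewrite scalemxAl -vA -mulmxA wA scalemxAr.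
move/eqP; rewrite -subr_eq0 -scalerBl scaler_eq0 (negPf wN) orbF subr_eq0.
move=> zz; have zE : z = ((complex.Re z)%:C)%C.
  move: zz; rewrite {vA wA}; case: z => a b /=; rewrite eq_complex/= eqxx/=.
  by rewrite -addr_eq0 -mulr2n mulrn_eq0/= => /eqP ->.
exists (complex.Re z) => //; rewrite -eigenvalue_root_char.
rewrite -(eigenvalue_map (real_complex R)).
by apply/eigenvalueP; exists v => //; rewrite [LHS]vA {1}zE.
Qed.

Lemma horner_mx_intertwine (F : fieldType) m n (A : 'M[F]_m.+1) (B : 'M[F]_n.+1)
    (Y : 'M[F]_(m.+1, n.+1)) (p : {poly F}) :
  A *m Y = Y *m B -> horner_mx A p *m Y = Y *m horner_mx B p.
Proof.
move=> AY; elim/poly_ind: p => [|p c IH]; first by rewrite !rmorph0 mul0mx mulmx0.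
rewrite !rmorphD !rmorphM/= !horner_mx_X !horner_mx_C mulmxDl mulmxDr.
by rewrite -mulmxA AY mulmxA IH -mulmxA mul_scalar_mx mul_mx_scalar.
Qed.

(** Every polynomial intertwines as well, so q(A)(A - lam I)Y vanishes by
    Cayley-Hamilton for B; the Bezout relation and Cayley-Hamilton for A make
    q(A) invertible. *)
Lemma coprime_intertwine_eq0 (F : fieldType) m n (A : 'M[F]_m) (B : 'M[F]_n)
    (Y : 'M[F]_(m, n)) (lam : F) (q : {poly F}) :
  A *m Y = Y *m B -> char_poly B = q * ('X - lam%:P) ->
  coprimep q (char_poly A) -> (A - lam%:M) *m Y = 0.
Proof.
case: m A Y => [|m] A Y; first by move=> *; apply/matrixP => -[].
case: n B Y => [|n] B Y; first by move=> *; apply/matrixP => ? [].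
move=> AY BE /Bezout_eq1_coprimepP[[u v]/= uv].
have : horner_mx A (q * ('X - lam%:P)) *m Y = 0.
  by rewrite (horner_mx_intertwine _ AY) -BE Cayley_Hamilton mulmx0.
rewrite rmorphM/= rmorphB/= horner_mx_X horner_mx_C -mulmxA.
move/(congr1 (mulmx (horner_mx A u))); rewrite mulmx0 mulmxA.
have -> : horner_mx A u *m horner_mx A q = 1%:M.
  rewrite -[LHS](rmorphM (horner_mx A)) -[u * q](addrK (v * char_poly A)) uv.
  by rewrite rmorphB rmorphM/= Cayley_Hamilton mulr0 subr0 rmorph1.
by rewrite mul1mx.
Qed.

(** With q the quotient of the characteristic polynomial of B by X - lam, a
    complex common root of q and of the characteristic polynomial of A is
    real, hence equal to lam, which the simplicity of lam excludes. *)
Lemma symmetric_intertwine (R : rcfType) m n (A : 'M[R]_m) (B : 'M[R]_n)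
    (Y : 'M[R]_(m, n)) (lam : R) :
  A^T = A -> (forall mu, eigenvalue A mu && eigenvalue B mu = (mu == lam)) ->
  mup lam (char_poly B) = 1%N -> A *m Y = Y *m B ->
  (A - lam%:M) *m Y = 0 /\ Y *m (B - lam%:M) = 0.
Proof.
move=> Asym common multB AY.
have chB0 : char_poly B != 0 by rewrite monic_neq0 ?char_poly_monic.
suff AY0 : (A - lam%:M) *m Y = 0.
  (* Y(B - lam I) and (A - lam I)Y coincide. *)
  split=> //; rewrite -AY0 mulmxBr mulmxBl AY.
  by rewrite mul_scalar_mx mul_mx_scalar.
have : 'X - lam%:P %| char_poly B by rewrite XsubC_dvd// multB.
case/Pdiv.Field.dvdpP => q BE.
have qlam : ~~ root q lam.
  apply/negP => /factor_theorem[r rE]; have := mup_geq lam 2 chB0.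
  by rewrite multB BE rE -mulrA -expr2 dvdp_mull.
apply: (coprime_intertwine_eq0 AY BE).
rewrite -(coprimep_map (real_complex R)).
apply: Pdiv.ClosedField.root_coprimep => z qz; apply/negP => Az.
have [x zE Ax] := symmetric_char_poly_root_real Asym Az.
move: qz; rewrite zE fmorph_root => qx.
have : x == lam.
  by rewrite -common !eigenvalue_root_char Ax BE rootM qx.
by move/eqP => xl; rewrite xl (negPf qlam) in qx.
Qed.

(** Geometric multiplicity is at most algebraic multiplicity: after a change of
    basis on the left, n - rank rows of X - A are multiples of X - lam, and
    these factors come out of the determinant. *)
Lemma corank_le_mup (F : fieldType) n (A : 'M[F]_n) (lam : F) :
  (n - \rank (A - lam%:M)%R <= mup lam (char_poly A))%N.
Proof.
set N := A - lam%:M; set r := \rank N.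
have ch0 : char_poly A != 0 by rewrite monic_neq0 ?char_poly_monic.
rewrite mup_geq//.
pose P := map_mx (@polyC F) (invmx (col_ebase N)).
have detP : \det P = (\det (invmx (col_ebase N)))%:P by rewrite det_map_mx.
have detP0 : \det (invmx (col_ebase N)) != 0.
  by have := col_ebase_unit N; rewrite -unitmx_inv unitmxE unitfE.
have PN : invmx (col_ebase N) *m N = pid_mx r *m row_ebase N.
  by rewrite -[X in _ *m X = _](mulmx_ebase N) -mulmxA mulKmx ?col_ebase_unit.
(* Row i of P (X - A) is (X - lam) times row i of P for r <= i. *)
pose D : 'rV[{poly F}]_n := \row_i (if (i < r)%N then 1 else 'X - lam%:P).
pose Q : 'M[{poly F}]_n := \matrix_(i, j)
  (if (i < r)%N then (P *m char_poly_mx A) i j else P i j).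
have PA : P *m char_poly_mx A = diag_mx D *m Q.
  apply/matrixP => i j; rewrite mul_diag_mx [RHS]mxE [D _ _]mxE [Q _ _]mxE.
  case: ifPn => [_|ri]; first by rewrite mul1r.
  have -> : (P *m char_poly_mx A) i j
    = (P *m (('X - lam%:P)%:M - map_mx polyC N)) i j.
    rewrite [LHS]mxE [RHS]mxE; apply: eq_bigr => k _; congr (_ * _).
    rewrite !mxE rmorphB/= !rmorphMn/=.
    by rewrite mulrnBl opprB addrA subrK.
  have N0 : map_mx polyC (pid_mx r *m row_ebase N) i j = 0.
    rewrite mxE [X in X%:P](_ : _ = 0)// mxE big1// => k _.
    by rewrite mxE (negPf ri) andbF mul0r.
  rewrite mulmxBr mul_mx_scalar -map_mxM PN [LHS]mxE [X in _ + X]mxE.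
  by rewrite N0 subr0 [LHS]mxE.
have : \det P * char_poly A = \det (diag_mx D) * \det Q.
  by rewrite -!det_mulmx PA.
rewrite detP det_diag => PE.
rewrite -(dvdpZr _ _ detP0) -mul_polyC PE.
apply: dvdp_mulr.
rewrite (eq_bigr (fun i : 'I_n => if (i < r)%N then 1 else 'X - lam%:P)); last first.
  by move=> i _; rewrite mxE.
rewrite (bigID (fun i : 'I_n => (i < r)%N))/= dvdp_mull//.
rewrite (eq_bigr (fun=> 'X - lam%:P)); last by move=> i /negPf ->.
rewrite prodr_const dvdp_exp2l//.
rewrite leq_subLR -[X in (X <= _)%N](card_ord n).
rewrite -(cardC (fun i : 'I_n => (i < r)%N)) leq_add2r.
have rn : (r <= n)%N := rank_leq_row N.
by rewrite -sum1_card (big_ord_narrow rn) sum1_card card_ord.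
Qed.

(** * Kernels and generic subspaces *)
Lemma mem_ker_col (R : realType) n (N : 'M[R]_n) (w : 'cV[R]_n) :
  (w \in ker_col N) = (N *m w == 0).
Proof. by rewrite /ker_col memv_ker lfunE. Qed.

Lemma dim_ker_col_le (R : realType) n (N : 'M[R]_n) :
  (\dim (ker_col N) <= n - \rank N)%N.
Proof.
set V := ker_col N; set X := vbasis V.
pose W : 'M[R]_(\dim V, n) := \matrix_(j < \dim V) (X`_j)^T.
have Wfree : row_free W.
  apply: inj_row_free => c cW0; apply/rowP => j; rewrite mxE.
  have /freeP/(_ (fun i => c 0 i)) Xfree := basis_free (vbasisP V).
  apply: Xfree.
  apply: trmx_inj; rewrite linear0 -cW0 mulmx_sum_row linear_sum/=.
  by apply: eq_bigr => i _; rewrite linearZ/= rowK.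
rewrite -(mxrank_tr N) -mxrank_ker -(eqP Wfree); apply: mxrankS.
apply/sub_kermxP/row_matrixP => j; rewrite row_mul rowK row0 -trmx_mul.
apply: trmx_inj; rewrite trmxK linear0; apply/eqP; rewrite -mem_ker_col.
by apply: vbasis_mem; rewrite mem_nth// size_tuple.
Qed.

(** Restricting to zero entries of w an equation w = W c over a basis W of V
    leaves an invertible square system for c. *)
Lemma generic_eq0 (R : realType) n (V : {vspace 'cV[R]_n}) (w : 'cV[R]_n)
    (Z : {set 'I_n}) :
  generic V -> w \in V -> (\dim V <= #|Z|)%N -> (forall i, i \in Z -> w i 0 = 0) ->
  w = 0.
Proof.
move=> [W [Wbasis Wminor]] wV dimZ wZ.
have [c wE] : exists c, w = W *m c.
  have : w \in limg (linfun (mulmx W : 'cV[R]_(\dim V) -> 'cV[R]_n)).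
    move: w wV {wZ}; apply/subvP; rewrite -{1}(span_basis Wbasis).
    apply/span_subvP => _ /imageP[j _ ->].
    by rewrite colE -[_ *m _](lfunE (mulmx W)) memv_img ?memvf.
  by case/memv_imgP => c _ ->; exists c; rewrite lfunE.
pose f (j : 'I_(\dim V)) := enum_val (widen_ord dimZ j).
have finj : injective f.
  by move=> i j /enum_val_inj/(congr1 val)/= /val_inj.
have : rowsub f W *m c = 0.
  rewrite mul_rowsub_mx -wE; apply/colP => j; rewrite !mxE.
  by apply: wZ; exact: enum_valP.
move/(congr1 (mulmx (invmx (rowsub f W)))).
by rewrite mulKmx ?Wminor// mulmx0 wE => ->; rewrite mulmx0.
Qed.

(** * Liberation sets of a direct sum *)
Lemma mem_nonedges n (G : sgraph n) (i j : 'I_n) :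
  ([set i; j] \in edges (compl G)) = (i != j) && ([set i; j] \notin edges G).
Proof. by rewrite in_setD [X in _ && X]inE cards2 andbC; case: (i != j). Qed.

Section DisjointUnionEdges.
Variables m n : nat.
Implicit Types (G : sgraph m) (H : sgraph n) (b : {set 'I_m * 'I_n}).

Definition cross_pair (p : 'I_m * 'I_n) : {set 'I_(m + n)} :=
  [set lshift n p.1; rshift m p.2].

Lemma cross_pair_inj : injective cross_pair.
Proof.
move=> [u v] [u' v'] /setP E.
have := E (lshift n u); have := E (rshift m v).
rewrite !inE !eqxx/= orbT (inj_eq (@lshift_inj _ _)) (inj_eq (@rshift_inj _ _)).
by rewrite !eq_rlshift eq_lrshift orbF /= => /esym/eqP -> /esym/eqP ->.
Qed.

Lemma mem_cross_pairs b p : (cross_pair p \in cross_pairs b) = (p \in b).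
Proof. exact: (mem_imset _ _ cross_pair_inj). Qed.

Lemma lshift_pair (i j : 'I_m) :
  [set lshift n i; lshift n j] = lshift n @: [set i; j].
Proof. by rewrite imsetU !imset_set1. Qed.

Lemma rshift_pair (i j : 'I_n) :
  [set rshift m i; rshift m j] = @rshift m n @: [set i; j].
Proof. by rewrite imsetU !imset_set1. Qed.

Lemma disj_union_edge_l G H (i j : 'I_m) :
  ([set lshift n i; lshift n j] \in edges (disj_union G H))
    = ([set i; j] \in edges G).
Proof.
rewrite inE lshift_pair (mem_imset _ _ (imset_inj (@lshift_inj _ _))).
rewrite orbC; case: imsetP => // -[e _ /setP/(_ (lshift n i))].
rewrite imset_f ?inE ?eqxx// => /esym/imsetP[x _ /eqP].
by rewrite eq_lrshift.
Qed.

Lemma disj_union_edge_r G H (i j : 'I_n) :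
  ([set rshift m i; rshift m j] \in edges (disj_union G H))
    = ([set i; j] \in edges H).
Proof.
rewrite inE rshift_pair (mem_imset _ _ (imset_inj (@rshift_inj _ _))).
case: imsetP => // -[e _ /setP/(_ (rshift m i))].
rewrite imset_f ?inE ?eqxx// => /esym/imsetP[x _ /eqP].
by rewrite eq_rlshift.
Qed.

Lemma disj_union_cross_pair G H p :
  (cross_pair p \in edges (disj_union G H)) = false.
Proof.
rewrite inE; apply/norP; split; apply/imsetP => -[e _ /setP E].
  have := E (rshift m p.2); rewrite !inE eqxx orbT => /esym/imsetP[x _ /eqP].
  by rewrite eq_rlshift.
have := E (lshift n p.1); rewrite !inE eqxx/= => /esym/imsetP[x _ /eqP].
by rewrite eq_lrshift.
Qed.

Lemma cross_pairs_nonedges G H b :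
  cross_pairs b \subset edges (compl (disj_union G H)).
Proof.
apply/subsetP => e /imsetP[p _ ->].
by rewrite mem_nonedges eq_lrshift/= -/(cross_pair p) disj_union_cross_pair.
Qed.

End DisjointUnionEdges.

Lemma inS_direct_sum (R : realType) m n (G : sgraph m) (H : sgraph n)
    (A : 'M[R]_m) (B : 'M[R]_n) :
  inS G A -> inS H B -> inS (disj_union G H) (direct_sum A B).
Proof.
move=> [Asym AG] [Bsym BH]; split.
  by rewrite /direct_sum tr_block_mx Asym Bsym !trmx0.
move=> i j; rewrite /direct_sum.
case: (split_ordP i) => u ->; case: (split_ordP j) => v ->.
- by rewrite block_mxEul disj_union_edge_l (inj_eq (@lshift_inj _ _)) => /AG.
- by rewrite block_mxEur mxE eqxx -/(cross_pair (u, v)) disj_union_cross_pair.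
- rewrite block_mxEdl mxE eqxx setUC -/(cross_pair (v, u)).
  by rewrite disj_union_cross_pair.
- by rewrite block_mxEdr disj_union_edge_r (inj_eq (@rshift_inj _ _)) => /BH.
Qed.

Lemma commutator_direct_sum (R : realType) m n (A : 'M[R]_m) (B : 'M[R]_n)
    (X : 'M[R]_(m + n)) :
  commutator (direct_sum A B) X = 0 ->
  [/\ commutator A (ulsubmx X) = 0, commutator B (drsubmx X) = 0
    & A *m ursubmx X = ursubmx X *m B].
Proof.
rewrite /commutator /direct_sum -{1 2}(submxK X) !mulmx_block.
rewrite !(mul0mx, mulmx0, addr0, add0r) => /subr0_eq/eq_block_mx[-> -> _ ->].
by rewrite !subrr.
Qed.

Lemma char_poly_direct_sum (R : realType) m n (A : 'M[R]_m) (B : 'M[R]_n) :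
  char_poly (direct_sum A B) = char_poly A * char_poly B.
Proof.
rewrite /char_poly /char_poly_mx /direct_sum map_block_mx !map_mx0.
by rewrite scalar_mx_block opp_block_mx add_block_mx !subr0 det_ublock.
Qed.

(** The hypothesis on b is the only property of the set that matters: deleting
    one pair leaves at least k rows of the off-diagonal block of X in which
    some entry is forced to vanish. *)
Lemma direct_sum_liberation (R : realType) m n (G : sgraph m) (H : sgraph n)
    (A : 'M[R]_m) (B : 'M[R]_n) (lam : R) (k : nat) (b : {set 'I_m * 'I_n}) :
  SSP G A -> SSP H B ->
  (forall mu : R, (eigenvalue A mu && eigenvalue B mu) = (mu == lam)) ->
  spec A lam = k -> spec B lam = 1%N ->
  generic (ker_col (A - lam%:M)) -> generic (ker_col (B - lam%:M)) ->
  b != set0 -> (forall p, p \in b -> k <= #|[set q.1 | q in b :\ p]|)%N ->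
  SSP_liberation (disj_union G H) (direct_sum A B) (cross_pairs b).
Proof.
move=> [AG sspA] [BH sspB] common multA multB genA genB b0 bP.
have bD := cross_pairs_nonedges G H b.
have dimA : (\dim (ker_col (A - lam%:M)) <= k)%N.
  by rewrite (leq_trans (dim_ker_col_le _))// -multA corank_le_mup.
have dimB : (\dim (ker_col (B - lam%:M)) <= 1)%N.
  by rewrite (leq_trans (dim_ker_col_le _))// -multB corank_le_mup.
split=> //; first exact: inS_direct_sum.
  by have [p pb] := set0Pn _ b0; apply/set0Pn; exists (cross_pair p);
    rewrite mem_cross_pairs.
move=> b' b'b card_b' X [Xsym X0 Xnz] comm.
have Xnz_D (i j : 'I_(m + n)) :
    X i j != 0 -> [set i; j] \in edges (compl (disj_union G H)).
  move=> /Xnz; rewrite !mem_nonedges => /andP[->].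
  by rewrite in_setU negb_or => /andP[].
have Xz (i j : 'I_(m + n)) :
    [set i; j] \in edges (add_edges (disj_union G H) b') -> X i j = 0.
  move=> ij; apply/eqP; apply: contraTT ij => /Xnz.
  by rewrite in_setD => /andP[].
(* By cardinality, b' consists of all the pairs of b but one. *)
have [p pb b'p] : exists2 p, p \in b & forall q, q \in b :\ p -> cross_pair q \in b'.
  have [e eb eb'] : exists2 e, e \in cross_pairs b & e \notin b'.
    apply/subsetPn; apply: contraTN isT => /subset_leq_card.
    rewrite card_b' leqNgt ltn_predL card_gt0 negbK => /eqP cb0.
    have [q qb] := set0Pn _ b0.
    by have := mem_cross_pairs b q; rewrite qb cb0 inE.
  case/imsetP: (eb) => p pb ep; exists p => // q /setD1P[qp qb].
  have -> : b' = cross_pairs b :\ e.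
    apply/eqP; rewrite eqEcard subsetD1 b'b eb'/=.
    by rewrite card_b' (cardsD1 e (cross_pairs b)) eb.
  rewrite !inE mem_cross_pairs qb ep andbT -/(cross_pair p).
  by rewrite (inj_eq (@cross_pair_inj _ _)).
have [commA commB AY] := commutator_direct_sum comm.
have ulX : ulsubmx X = 0.
  apply: sspA commA; split.
  - by rewrite -[in RHS]Xsym trmx_ulsub.
  - by move=> i; rewrite !mxE X0.
  - move=> i j; rewrite !mxE => /Xnz_D; rewrite !mem_nonedges.
    by rewrite disj_union_edge_l (inj_eq (@lshift_inj _ _)).
have drX : drsubmx X = 0.
  apply: sspB commB; split.
  - by rewrite -[in RHS]Xsym trmx_drsub.
  - by move=> i; rewrite !mxE X0.
  - move=> i j; rewrite !mxE => /Xnz_D; rewrite !mem_nonedges.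
    by rewrite disj_union_edge_r (inj_eq (@rshift_inj _ _)).
set Y := ursubmx X in AY *.
have Yz q : q \in b :\ p -> Y q.1 q.2 = 0.
  move=> /b'p qb'; rewrite !mxE; apply: Xz; rewrite inE; apply/orP; right.
  by rewrite in_setI qb' (subsetP bD)// (subsetP b'b).
have [Asym _] := AG; have [Bsym _] := BH.
have [AY0 YB0] := symmetric_intertwine Asym common multB AY.
have Yrow q : q \in b :\ p -> row q.1 Y = 0.
  move=> qb; apply: trmx_inj; rewrite linear0.
  apply: (generic_eq0 (Z := [set q.2]) genB); rewrite ?cards1//.
    rewrite mem_ker_col -[B]Bsym -(tr_scalar_mx _ lam) -linearB/= -trmx_mul.
    by rewrite -row_mul YB0 row0 linear0.
  by move=> v; rewrite inE => /eqP ->; rewrite 2!mxE; exact: Yz.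
have Y0 : Y = 0.
  apply: trmx_inj; apply/row_matrixP => v; rewrite -tr_col linear0 row0.
  apply: trmx_inj; rewrite trmxK linear0.
  apply: (generic_eq0 (Z := [set q.1 | q in b :\ p]) genA).
  - by rewrite mem_ker_col colE mulmxA AY0 mul0mx.
  - exact: leq_trans dimA (bP _ pb).
  - move=> _ /imsetP[q qb ->]; have /rowP/(_ v) := Yrow _ qb.
    by rewrite !mxE.
rewrite -(submxK X) ulX drX -/Y Y0 -[dlsubmx X]trmxK trmx_dlsub Xsym -/Y Y0.
by rewrite trmx0 block_mx_const.
Qed.

(** * Norm estimates for matrices *)
Section MatrixNorm.
Variable R : realType.

Lemma mx_entry_le_norm m n (A : 'M[R]_(m, n)) i j : `|A i j| <= `|A|.
Proof.
rewrite [leRHS]/Num.norm/= mx_normrE.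
by apply/bigmax_geP; right; exists (i, j).
Qed.

Lemma mx_norm_le m n (A : 'M[R]_(m, n)) (r : R) :
  0 <= r -> (forall i j, `|A i j| <= r) -> `|A| <= r.
Proof.
move=> r0 Ar; rewrite [leLHS]/Num.norm/= mx_normrE.
by apply/bigmax_leP; split=> // ? _; exact: Ar.
Qed.

Lemma mx_norm_mulmx_le m n p (A : 'M[R]_(m, n)) (B : 'M[R]_(n, p)) :
  `|A *m B| <= n%:R * `|A| * `|B|.
Proof.
apply: mx_norm_le => [|i j]; first by rewrite !mulr_ge0.
rewrite mxE (le_trans (ler_norm_sum _ _ _))//.
rewrite -mulrA -[n in n%:R]card_ord mulr_natl -sumr_const.
by apply: ler_sum => k _; rewrite normrM ler_pM ?mx_entry_le_norm.
Qed.

Lemma mx_norm_commutator_le n (A X : 'M[R]_n) :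
  `|commutator A X| <= n%:R *+ 2 * `|A| * `|X|.
Proof.
rewrite mulr2n 2!mulrDl (le_trans (ler_normB _ _))//.
by rewrite lerD ?mx_norm_mulmx_le// -mulrA (mulrC `|A|) mulrA mx_norm_mulmx_le.
Qed.

Lemma linear_mx_bounded m n (W : normedModType R) (f : {linear 'M[R]_(m, n) -> W}) :
  exists2 c : R, 0 < c & forall A, `|f A| <= c * `|A|.
Proof.
exists (1 + \sum_i \sum_j `|f (delta_mx i j)|) => [|A].
  by rewrite ltr_pwDl// sumr_ge0// => i _; rewrite sumr_ge0.
rewrite [in leLHS](matrix_sum_delta A) linear_sum mulrDl mul1r ler_wpDl//.
rewrite (le_trans (ler_norm_sum _ _ _))// mulr_suml ler_sum// => i _.
rewrite linear_sum (le_trans (ler_norm_sum _ _ _))// mulr_suml ler_sum// => j _.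
by rewrite linearZ normrZ mulrC ler_wpM2l// mx_entry_le_norm.
Qed.

End MatrixNorm.

(** * Linear algebra over an ordered field *)
Lemma mxtrace_mul_tr_le0 (R : realDomainType) m n (A : 'M[R]_(m, n)) :
  \tr (A *m A^T) <= 0 -> A = 0.
Proof.
move=> trA; apply/matrixP => i j; rewrite mxE; apply/eqP; rewrite -sqrf_eq0.
have trE : \tr (A *m A^T) = \sum_i \sum_j A i j ^+ 2.
  by apply: eq_bigr => k _; rewrite mxE; apply: eq_bigr => l _; rewrite mxE -expr2.
have ge0 k : 0 <= \sum_j A k j ^+ 2 by apply: sumr_ge0 => l _; exact: sqr_ge0.
have /eqP : \sum_k \sum_j A k j ^+ 2 = 0.
  by apply/eqP; rewrite eq_le -trE trA trE sumr_ge0.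
rewrite psumr_eq0// => /allP/(_ i); rewrite mem_index_enum => /(_ isT)/=.
rewrite psumr_eq0; last by move=> l _; exact: sqr_ge0.
by move=> /allP/(_ j); rewrite mem_index_enum => /(_ isT).
Qed.

Lemma injective_linear_rinv (F : fieldType) (vT : vectType F)
    (f : {linear vT -> vT}) :
  injective f -> exists g : {linear vT -> vT}, cancel g f.
Proof.
move=> finj; have kf : lker (linfun f) == 0%VS.
  by apply/lker0P => x y; rewrite !lfunE => /finj.
exists (fun_of_lfun (linfun f)^-1%VF) => x.
by rewrite -[LHS](lfunE f) lker0_lfunVK.
Qed.

Lemma exists_nonroot (R : numDomainType) (p : {poly R}) :
  p != 0 -> exists x, ~~ root p x.
Proof.
move=> p0; pose rs := [seq (i%:R : R) | i <- iota 0 (size p)].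
have urs : uniq rs.
  by rewrite map_inj_uniq ?iota_uniq//; apply: mulrIn; rewrite oner_eq0.
have : ~~ all (root p) rs.
  apply/negP => /(max_poly_roots p0)/(_ urs).
  by rewrite size_map size_iota ltnn.
by case/allPn => x _ ?; exists x.
Qed.

(** Take a_j = x ^ rank(j): the i-th condition is then that x avoids the roots
    of a polynomial with c i i among its coefficients, and a single x avoids
    the roots of all of them. *)
Lemma generic_combination (R : numDomainType) (I : finType) (S : {set I})
    (c : I -> I -> R) :
  (forall i, i \in S -> c i i != 0) ->
  exists a : I -> R, forall i, i \in S -> \sum_j a j * c j i != 0.
Proof.
move=> cii.
pose p i := \poly_(k < #|I|)
  (if insub k is Some k' then c (enum_val (k' : 'I_#|I|)) i else 0).
have pE i x : (p i).[x] = \sum_j x ^+ enum_rank j * c j i.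
  rewrite horner_poly (reindex _ (onW_bij _ (@enum_val_bij I)))/=.
  apply: eq_bigr => k _; rewrite insubT//= => ?; rewrite mulrC enum_valK.
  by congr (_ * c _ _); congr enum_val; exact: val_inj.
have p0 : \prod_(i in S) p i != 0.
  rewrite prodf_seq_neq0; apply/allP => i _; apply/implyP => iS.
  apply/eqP => /polyP/(_ (enum_rank i)); rewrite coef0 coef_poly ltn_ord.
  rewrite insubT// => ?.
  have -> : Sub (nat_of_ord (enum_rank i)) _ = enum_rank i.
    by move=> H; exact: val_inj.
  by rewrite enum_rankK => /eqP; rewrite (negPf (cii _ iS)).
have [x] := exists_nonroot p0; rewrite /root horner_prod => xp.
exists (fun j => x ^+ enum_rank j) => i iS; rewrite -pE.
by apply: contra_neq xp => pi0; rewrite (bigD1 i)//= pi0 mul0r.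
Qed.

(** * Solving an equation with a second-order remainder *)

(** For a remainder q that is r-Lipschitz up to a constant on the ball of radius
    r, the map z |-> q(t u0 + L z) is, for small t, a contraction of the ball of
    radius s t / c: its values there are O(t^2) and its Lipschitz constant is
    O(t).  The radius is chosen so that the correction L z to t u0 stays below
    s t, for s arbitrarily small. *)
Lemma perturbed_fixed_point (R : realType) (V : completeNormedModType R)
    (W : normedModType R) (q : W -> V) (L : V -> W) (a c s : R) (u0 : W) :
    0 < a -> 0 < c -> 0 < s ->
    (forall r u v, r <= 1 -> `|u| <= r -> `|v| <= r ->
       `|q u - q v| <= a * r * `|u - v|) -> q 0 = 0 ->
    (forall y z, `|L y - L z| <= c * `|y - z|) -> L 0 = 0 ->
  \forall t \near ((0 : R)^'+)%classic,
    exists2 z, q (t *: u0 + L z) = z & `|L z| <= s * t.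
Proof.
move=> a0 c0 s0 qlip q0 Llip L0.
pose b := `|u0| + s.
have b0 : 0 < b by rewrite ltr_wpDl.
have p0 : 0 < a * b ^+ 2 * c by rewrite !mulr_gt0// exprn_gt0.
have p1 : 0 < a * b * c by rewrite !mulr_gt0.
near=> t.
have t0 : 0 < t by near: t; exact: nbhs_right_gt.
have tb1 : t * b <= 1.
  rewrite -ler_pdivlMr// div1r; near: t; apply: nbhs_right_le.
  by rewrite invr_gt0.
have tself : t * (a * b ^+ 2 * c) <= s.
  by rewrite -ler_pdivlMr//; near: t; apply: nbhs_right_le; rewrite divr_gt0.
have tcontr : t * (a * b * c) <= 2^-1.
  rewrite -ler_pdivlMr//; near: t; apply: nbhs_right_le.
  by rewrite divr_gt0// invr_gt0.
pose f z := q (t *: u0 + L z).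
pose rho := s * t / c.
have rho0 : 0 < rho by rewrite !mulr_gt0// invr_gt0.
have Lle z : `|z| <= rho -> `|L z| <= s * t.
  move=> zr; have := Llip z 0; rewrite L0 !subr0 => /le_trans; apply.
  by rewrite mulrC -ler_pdivlMr.
have ule z : `|z| <= rho -> `|t *: u0 + L z| <= t * b.
  move=> zr; rewrite (le_trans (ler_normD _ _))// normrZ gtr0_norm// mulrDr.
  by rewrite lerD2l (mulrC t s) Lle.
pose U := closed_ball_ Num.norm (0 : V) rho.
have UE z : U z = (`|z| <= rho) :> Prop by rewrite /U /closed_ball_/= sub0r normrN.
have fU : set_fun U U f.
  move=> z /=; rewrite !UE => zr.
  have := qlip (t * b) (t *: u0 + L z) 0 tb1 (ule _ zr).
  rewrite normr0 q0 !subr0 => /(_ (mulr_ge0 (ltW t0) (ltW b0))) /le_trans; apply.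
  apply: (@le_trans _ _ (a * (t * b) * (t * b))).
    by rewrite ler_pM2l ?mulr_gt0// ule.
  rewrite ler_pdivlMr//.
  have -> : a * (t * b) * (t * b) * c = (t * (a * b ^+ 2 * c)) * t by ring.
  by rewrite ler_pM2r.
pose F := mkfun_fun fU.
have contrF : is_contraction F.
  exists 2^-1%:nng; split; first by rewrite /= invf_lt1// ltr1n.
  move=> [y z] [/=]; rewrite !UE => yr zr.
  apply: le_trans (qlip (t * b) _ _ tb1 (ule _ yr) (ule _ zr)) _.
  rewrite opprD addrACA subrr add0r.
  apply: (@le_trans _ _ (a * (t * b) * (c * `|y - z|))).
    by rewrite ler_pM2l ?mulr_gt0.
  rewrite mulrA ler_wpM2r//.
  by have -> : a * (t * b) * c = t * (a * b * c) by ring.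
have [||z Uz zE] := banach_fixed_point contrF.
- exact: closed_closed_ball_.
- by exists 0; rewrite UE normr0 ltW.
exists z; first by rewrite [RHS]zE.
by apply: Lle; rewrite -UE.
Unshelve. all: by end_near. Qed.

(** * The strong spectral property as definiteness of an operator *)
Section StrongSpectralProperty.
Variables (R : realType) (n : nat).
Implicit Types (H : sgraph n) (M X : 'M[R]_n).

Definition graph_part H X : 'M[R]_n :=
  \matrix_(i, j) (if (i == j) || ([set i; j] \in edges H) then X i j else 0).

Fact graph_part_is_linear H : linear (graph_part H).
Proof.
move=> a X Y; apply/matrixP => i j; rewrite !mxE.
by case: ifP => // _; rewrite mulr0 addr0.
Qed.
HB.instance Definition _ H :=
  GRing.isLinear.Build R 'M[R]_n 'M[R]_n *:%R (graph_part H)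
    (graph_part_is_linear H).

Fact commutator_is_linear M : linear (@commutator R n M).
Proof.
move=> a X Y; rewrite /commutator mulmxDr mulmxDl -scalemxAr -scalemxAl.
by rewrite scalerBr opprD addrACA.
Qed.
HB.instance Definition _ M :=
  GRing.isLinear.Build R 'M[R]_n 'M[R]_n *:%R (@commutator R n M)
    (commutator_is_linear M).

Lemma trmx_commutator M X : (commutator M X)^T = - commutator M^T X^T.
Proof. by rewrite /commutator linearB/= !trmx_mul opprB. Qed.

Lemma trmx_graph_part H X : (graph_part H X)^T = graph_part H X^T.
Proof. by apply/matrixP => i j; rewrite !mxE eq_sym setUC. Qed.

Lemma graph_part0_inS0cl H X :
  X^T = X -> graph_part H X = 0 -> inS0cl (compl H) X.
Proof.
move=> Xsym /matrixP X0; split=> // [i|i j Xij].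
  by have := X0 i i; rewrite !mxE eqxx.
have := X0 i j; rewrite !mxE.
case: ifP => [_ /eqP|/norP[ij ijH] _]; first by rewrite (negPf Xij).
by rewrite !inE ijH cards2 ij.
Qed.

Lemma inS0cl_graph_part0 H X : inS0cl (compl H) X -> graph_part H X = 0.
Proof.
case=> _ X0 XH; apply/matrixP => i j; rewrite !mxE.
have [<-|_/=] := eqVneq i j; first by rewrite X0.
case: ifP => // ijH.
by apply/eqP/negPn/negP => /XH; rewrite !inE ijH.
Qed.

(** This is L o L* for L(E, K) = E - [M, K] on pairs of a symmetric matrix
    supported on H and a skew matrix; its values are therefore sums of such an
    E and such a bracket. *)
Definition ssp_operator H M X :=
  graph_part H X + commutator M (commutator M X).

Fact ssp_operator_is_linear H M : linear (ssp_operator H M).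
Proof.
move=> a X Y; rewrite /ssp_operator graph_part_is_linear.
rewrite !commutator_is_linear.
by rewrite addrACA -scalerDr.
Qed.
HB.instance Definition _ H M :=
  GRing.isLinear.Build R 'M[R]_n 'M[R]_n *:%R (ssp_operator H M)
    (ssp_operator_is_linear H M).

Lemma trmx_ssp_operator H M X :
  M^T = M -> (ssp_operator H M X)^T = ssp_operator H M X^T.
Proof.
move=> Msym; rewrite /ssp_operator linearD/= trmx_graph_part.
by rewrite !trmx_commutator !Msym linearN opprK.
Qed.

(** The trace of X times the operator at X is |P(X)|^2 + |[M, X]|^2 in Frobenius
    norm, P being graph_part; the SSP says that both terms vanish only at 0. *)
Lemma ssp_operator_eq0 H M X :
  M^T = M -> X^T = X -> SSP_wrt H M -> ssp_operator H M X = 0 -> X = 0.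
Proof.
move=> Msym Xsym ssp XM0.
have trP : \tr (X *m graph_part H X) = \tr (graph_part H X *m (graph_part H X)^T).
  apply: eq_bigr => i _; rewrite !mxE; apply: eq_bigr => j _.
  have Xji : X j i = X i j by rewrite -{1}Xsym mxE.
  by rewrite !mxE Xji eq_sym setUC; case: ifP => // _; rewrite !mulr0.
have CT : (commutator M X)^T = - commutator M X by rewrite trmx_commutator Msym Xsym.
set Y := commutator M X in CT *.
have trC : \tr (X *m commutator M Y) = \tr (Y *m Y^T).
  have -> : commutator M Y = M *m Y - Y *m M by [].
  have -> : Y *m Y^T = (X *m M - M *m X) *m Y by rewrite CT mulmxN -mulNmx opprB.
  move: Y {CT} => Y.
  have trB (P Q : 'M[R]_n) : \tr (P - Q) = \tr P - \tr Q by rewrite linearB.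
  rewrite mulmxBr mulmxBl !trB (mulmxA X Y) (mxtrace_mulC (X *m Y)).
  by rewrite !mulmxA.
have tr0 : \tr (graph_part H X *m (graph_part H X)^T)
    + \tr (Y *m Y^T) = 0.
  by rewrite -trP -trC -linearD/= -mulmxDr -/(ssp_operator H M X) XM0 mulmx0 linear0.
have tr_ge0 (Z : 'M[R]_n) : 0 <= \tr (Z *m Z^T).
  apply: sumr_ge0 => i _; rewrite mxE; apply: sumr_ge0 => j _.
  by rewrite mxE -expr2 sqr_ge0.
apply: ssp; last by apply: mxtrace_mul_tr_le0; rewrite -tr0 lerDr.
by apply: graph_part0_inS0cl => //; apply: mxtrace_mul_tr_le0; rewrite -tr0 lerDl.
Qed.

(** An injective endomorphism of the symmetric matrices is onto.  To stay on the
    full matrix space, the operator is applied to the symmetric part of the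
    argument and completed by the identity on the skew part. *)
Lemma ssp_operator_rinv H M : M^T = M -> SSP_wrt H M ->
  exists g : {linear 'M[R]_n -> 'M[R]_n},
    (forall Z, (g Z)^T = g Z) /\ (forall Z, Z^T = Z -> ssp_operator H M (g Z) = Z).
Proof.
move=> Msym ssp.
pose f X := ssp_operator H M (X + X^T) + (X - X^T).
have f_lin : linear f.
  move=> a X Y; rewrite /f.
  have trP : (a *: X + Y)^T = a *: X^T + Y^T by rewrite linearP.
  rewrite trP opprD (addrACA _ Y) (addrACA _ Y) -scalerN -!scalerDr.
  by rewrite ssp_operator_is_linear addrACA -scalerDr.
pose fL := HB.pack_for {linear 'M[R]_n -> 'M[R]_n} f
  (GRing.isLinear.Build _ _ _ _ f f_lin).
have fT X : (f X)^T = ssp_operator H M (X + X^T) - (X - X^T).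
  have sT : (X + X^T)^T = X + X^T by rewrite linearD/= trmxK addrC.
  have kT : (X - X^T)^T = - (X - X^T) by rewrite linearB/= trmxK opprB.
  have -> : (f X)^T = (ssp_operator H M (X + X^T))^T + (X - X^T)^T.
    by rewrite /f linearD.
  by rewrite trmx_ssp_operator// sT kT.
have fskew X : (f X)^T = f X -> X^T = X.
  rewrite fT => /addrI/esym/eqP; rewrite -addr_eq0 -mulr2n -scaler_nat.
  by rewrite scaler_eq0 pnatr_eq0/= subr_eq0 => /eqP.
have finj : injective fL.
  move=> X Y /eqP; rewrite -subr_eq0 -linearB/= => /eqP fXY.
  apply/eqP; rewrite -subr_eq0; apply/eqP; set D := X - Y in fXY *.
  have Dsym : D^T = D by apply: fskew; rewrite fXY linear0.
  have DD : D + D = 0.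
    apply: (@ssp_operator_eq0 H M) => //; first by rewrite linearD/= Dsym.
    by move: fXY; rewrite /f Dsym subrr addr0.
  by move/eqP: DD; rewrite -mulr2n -scaler_nat scaler_eq0 pnatr_eq0 => /eqP.
have [g gK] := injective_linear_rinv finj.
pose h Z := g Z + (g Z)^T.
have h_lin : linear h.
  move=> a X Y; rewrite /h linearP/=.
  have -> : (a *: g X + g Y)^T = a *: (g X)^T + (g Y)^T by rewrite linearP.
  by rewrite addrACA -scalerDr.
exists (HB.pack_for {linear 'M[R]_n -> 'M[R]_n} h
  (GRing.isLinear.Build _ _ _ _ h h_lin)).
split=> Z /=; rewrite /h; first by rewrite linearD/= trmxK addrC.
move=> Zsym; have gsym : (g Z)^T = g Z by apply: fskew; rewrite (gK Z : f (g Z) = Z).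
by rewrite -[RHS](gK Z)/= /f gsym subrr addr0.
Qed.

Lemma SSP_wrt_sub H H' M :
  edges H \subset edges H' -> SSP_wrt H M -> SSP_wrt H' M.
Proof.
move=> HH' ssp X [Xsym X0 XH']; apply: ssp; split=> // i j /XH'.
rewrite !inE => /andP[ijH' ->].
by rewrite andbT (contra _ ijH')//; exact: (subsetP HH').
Qed.

(** If X violates the SSP of C, then P(X) = O and [M, X] = [M - C, X], so the
    operator attached to M sends X to a matrix of norm O(|C - M| |X|); a bound
    for its inverse rules this out when C is close to M. *)
Lemma SSP_wrt_open H M : M^T = M -> SSP_wrt H M ->
  exists2 d : R, 0 < d & forall C, `|C - M| < d -> SSP_wrt H C.
Proof.
move=> Msym ssp; have [g [gsym gK]] := ssp_operator_rinv Msym ssp.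
have [c c0 gc] := linear_mx_bounded g.
pose a : R := n%:R *+ 2.
have a0 : 0 <= a by rewrite mulrn_wge0.
pose b := c * (a * `|M| * a).
have b0 : 0 <= b by rewrite !mulr_ge0// ltW.
exists (b + 1)^-1 => [|C CM X XH XC]; first by rewrite invr_gt0 ltr_wpDl.
have [Xsym _ _] := XH.
pose Z := commutator M (commutator M X).
have Zsym : Z^T = Z by rewrite /Z !trmx_commutator !Msym Xsym linearN opprK.
have XE : X = g Z.
  apply/eqP; rewrite -subr_eq0; apply/eqP; apply: (@ssp_operator_eq0 H M) => //.
    by rewrite linearB/= gsym Xsym.
  by rewrite linearB/= gK// /ssp_operator inS0cl_graph_part0// add0r subrr.
have MX : commutator M X = commutator (M - C) X.
  rewrite -[LHS]subr0 -XC.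
  by rewrite /commutator mulmxBl mulmxBr !opprD !opprK addrACA.
apply/eqP; apply/negPn/negP; rewrite -normr_gt0 => X0.
suff : `|X| < `|X| by rewrite ltxx.
rewrite {1}XE; apply: le_lt_trans (gc _) _.
apply: (@le_lt_trans _ _ (c * (a * `|M| * (a * `|C - M| * `|X|)))).
  rewrite ler_pM2l// (le_trans (mx_norm_commutator_le _ _))//.
  rewrite ler_wpM2l// ?mulr_ge0// MX (le_trans (mx_norm_commutator_le _ _))//.
  by rewrite distrC.
have -> : c * (a * `|M| * (a * `|C - M| * `|X|)) = b * `|C - M| * `|X|.
  by rewrite /b; ring.
rewrite -[ltRHS]mul1r ltr_pM2r//.
apply: (@le_lt_trans _ _ ((b + 1) * `|C - M|)).
  by rewrite ler_wpM2r// lerDl.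
by rewrite mulrC -ltr_pdivlMr ?div1r// ltr_wpDl.
Qed.

End StrongSpectralProperty.

(** * Isospectral perturbations from the Cayley transform *)

(** A row v with v = - v K satisfies v v^T = - v K v^T, and v K v^T vanishes for
    K skew. *)
Lemma skew_add1_unitmx (R : realFieldType) n (K : 'M[R]_n) :
  K^T = - K -> 1%:M + K \in unitmx.
Proof.
move=> Kskew; rewrite -row_free_unit; apply: inj_row_free => v.
rewrite mulmxDr mulmx1 => /eqP; rewrite addr_eq0 => /eqP vE.
apply: mxtrace_mul_tr_le0.
have : \tr (v *m K *m v^T) = - \tr (v *m K *m v^T).
  rewrite -{1}mxtrace_tr !trmx_mul trmxK Kskew mulNmx mulmxN mulmxA.
  by rewrite linearN.
have -> : v *m K = - v by rewrite [in RHS]vE opprK.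
rewrite mulNmx linearN/= opprK => /eqP.
rewrite eq_sym -addr_eq0 -mulr2n mulrn_eq0/= => /eqP ->.
by rewrite lexx.
Qed.

(** This is similarity of A and B by P^-1 Q, in a form without inverses. *)
Lemma equivalent_char_poly (F : fieldType) n (A B P Q : 'M[F]_n) :
  P \in unitmx -> Q \in unitmx -> P *m Q = Q *m P ->
  P *m A *m Q = Q *m B *m P -> char_poly A = char_poly B.
Proof.
move=> Pu Qu PQ PAQ.
have detC (U : 'M[F]_n) : U \in unitmx -> \det (map_mx polyC U) != 0.
  by rewrite unitmxE unitfE det_map_mx polyC_eq0.
apply: (mulfI (detC _ Pu)); apply: (mulIf (detC _ Qu)).
rewrite [RHS]mulrC [X in _ = _ * X]mulrC [RHS]mulrA -!det_mulmx; congr (\det _).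
have E (U V N : 'M[F]_n) : map_mx polyC U *m char_poly_mx N *m map_mx polyC V
    = 'X *: map_mx polyC (U *m V) - map_mx polyC (U *m N *m V).
  rewrite /char_poly_mx mulmxBr mulmxBl mul_mx_scalar -scalemxAl.
  by rewrite -!map_mxM.
by rewrite !E PQ PAQ.
Qed.

(** The equation on E expands (I + K)(M + E)(I - K) = (I - K) M (I + K), so
    M + E is the conjugate of M by the Cayley transform of K, an orthogonal
    matrix. *)
Lemma cayley_char_poly (R : realFieldType) n (M E K : 'M[R]_n) :
  K^T = - K ->
  E = (M *m K - K *m M) *+ 2 + (E *m K - K *m E + K *m E *m K) ->
  char_poly (M + E) = char_poly M.
Proof.
move=> Kskew EE.
have Pu := skew_add1_unitmx Kskew.
have Qu : 1%:M - K \in unitmx by apply: skew_add1_unitmx; rewrite linearN/= Kskew.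
apply: (equivalent_char_poly Pu Qu).
  by rewrite !(mulmxDl, mulmxDr, mulmxN, mulNmx, mulmx1, mul1mx) !addrA subrK addrK.
rewrite !(mulmxDl, mulmxDr, mulmxN, mulNmx, mulmx1, mul1mx).
(* The products are atoms of an identity that is linear in each entry. *)
have {EE} : E - ((M *m K - K *m M) *+ 2 + (E *m K - K *m E + K *m E *m K)) = 0.
  by rewrite -EE subrr.
move: (M *m K) (K *m M) (E *m K) (K *m E) (K *m E *m K) (K *m M *m K) => a b c d e f.
move=> /matrixP EE; apply/matrixP => i j.
by have := EE i j; rewrite !mxE; lra.
Qed.

Lemma edges_add_edges n (G : sgraph n) (beta : {set {set 'I_n}}) :
  beta \subset edges (compl G) ->
  edges (add_edges G beta) = edges G :|: beta.
Proof. by move=> bG; rewrite /=; congr (_ :|: _); apply/setIidPl. Qed.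

(** * Liberation at constant spectrum *)

(** The SSP with respect to G + (beta minus e) provides a direction [M, K], tangent
    to the isospectral matrices and supported on G + beta, whose e-entry is
    nonzero.  So no hyperplane of vanishing e-entry contains all these
    directions, and a generic combination avoids all the hyperplanes. *)
Lemma liberation_direction (R : realType) n (G : sgraph n) (M : 'M[R]_n)
    (beta : {set {set 'I_n}}) :
  SSP_liberation G M beta ->
  exists K : 'M[R]_n,
    [/\ K^T = - K,
        graph_part (add_edges G beta) (commutator M K) = commutator M K
      & forall i j, [set i; j] \in beta -> commutator M K i j != 0].
Proof.
move=> [[Msym _] _ bG lib]; set H := add_edges G beta.
have HE : edges H = edges G :|: beta by exact: edges_add_edges.
have step (p : 'I_n * 'I_n) : exists K : 'M[R]_n,
    [/\ K^T = - K, graph_part H (commutator M K) = commutator M K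
      & [set p.1; p.2] \in beta -> commutator M K p.1 p.2 != 0].
  case: p => i j /=; set e := [set i; j].
  have [eb|eNb] := boolP (e \in beta); last first.
    by exists 0; rewrite !linear0; split.
  have : e \in edges (compl G) := subsetP bG _ eb.
  rewrite /= inE => /andP[eNG]; rewrite inE cards2 => /eqP [] ij'.
  have ij : i != j by case: (i != j) ij'.
  have bGe : beta :\ e \subset edges (compl G).
    by apply: subset_trans bG; rewrite subD1set.
  have ssp : SSP_wrt (add_edges G (beta :\ e)) M.
    by apply: lib; rewrite ?subD1set// (cardsD1 e beta) eb.
  (* Solving for the elementary matrix at e with H = G + (beta minus e): the
     part supported on H has no e-entry, so the bracket carries it. *)
  have [g [gsym gK]] := ssp_operator_rinv Msym ssp.
  pose Z : 'M[R]_n := delta_mx i j + delta_mx j i.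
  have Zsym : Z^T = Z by rewrite linearD/= !trmx_delta addrC.
  have ZE : commutator M (commutator M (g Z))
      = Z - graph_part (add_edges G (beta :\ e)) (g Z).
    by rewrite -[X in X - _](gK _ Zsym) /ssp_operator addrC addKr.
  exists (commutator M (g Z)); rewrite ZE; split.
  - by rewrite trmx_commutator Msym gsym.
  - apply/matrixP => a b; rewrite mxE HE.
    case: ifP => // /norP[ab]; rewrite !inE negb_or => /andP[abG abb].
    rewrite 2!mxE /graph_part !mxE (negPf ab) edges_add_edges//.
    rewrite !inE (negPf abG) (negPf abb) andbF/= subr0.
    have abe : [set a; b] != e by apply: contraNneq abb => ->.
    case: andP => [[/eqP ai /eqP bj]|_]; first by rewrite ai bj eqxx in abe.
    case: andP => [[/eqP aj /eqP bi]|_]; last by rewrite addr0.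
    by rewrite aj bi setUC eqxx in abe.
  - move=> _; rewrite 2!mxE /graph_part !mxE (negPf ij) edges_add_edges//.
    rewrite !inE (negPf eNG) !eqxx/=.
    by rewrite addr0 subr0 oner_eq0.
have [K_ K_P] := fin_all_exists step.
pose S := [set p : 'I_n * 'I_n | [set p.1; p.2] \in beta].
have [|a aP] := @generic_combination R _ S (fun q p => commutator M (K_ q) p.1 p.2).
  by move=> p; rewrite inE; case: (K_P p) => _ _; apply.
have CE : commutator M (\sum_p a p *: K_ p) = \sum_p a p *: commutator M (K_ p).
  by rewrite linear_sum; apply: eq_bigr => p _; rewrite linearZ.
exists (\sum_p a p *: K_ p); rewrite CE; split.
- rewrite linear_sum -sumrN; apply: eq_bigr => p _.
  by rewrite linearZ/= -scalerN; case: (K_P p) => ->.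
- rewrite linear_sum; apply: eq_bigr => p _.
  by rewrite linearZ/=; case: (K_P p) => _ ->.
- move=> i j ijb; have := aP (i, j); rewrite inE => /(_ ijb).
  apply: contra_neq => E0; rewrite -[RHS]E0 summxE.
  by apply: eq_bigr => p _; rewrite [RHS]mxE.
Qed.

(** Needed to apply the contraction principle to matrices. *)
HB.instance Definition _ (R : realType) m n := Complete.on 'M[R]_(m, n).

Section Liberation.
Variables (R : realType) (n : nat).

Let W : normedModType R := ('M[R]_n * 'M[R]_n)%type.

(** The second-order part, at u = (E, K), of the equation of
    cayley_char_poly. *)
Definition cayley_remainder (u : W) : 'M[R]_n :=
  commutator u.1 u.2 + u.2 *m u.1 *m u.2.

Lemma pair_norm_le (u : W) (r : R) : (`|u| <= r) = (`|u.1| <= r) && (`|u.2| <= r).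
Proof.
have -> : `|u| = Num.max `|u.1| `|u.2| by [].
by rewrite ge_max.
Qed.

Lemma commutator_sym_skew (A K : 'M[R]_n) :
  A^T = A -> K^T = - K -> (commutator A K)^T = commutator A K.
Proof.
move=> Asym Kskew; rewrite trmx_commutator Asym Kskew.
have -> : commutator A (- K) = - commutator A K by rewrite linearN.
by rewrite opprK.
Qed.

(** Telescoping each product factor by factor; the cubic term is absorbed in the
    quadratic ones because r <= 1. *)
Lemma cayley_remainder_lipschitz : exists2 a : R, 0 < a &
  forall r (u v : W), r <= 1 -> `|u| <= r -> `|v| <= r ->
    `|cayley_remainder u - cayley_remainder v| <= a * r * `|u - v|.
Proof.
pose N : R := n%:R; have N0 : 0 <= N by rewrite /N.
exists (4 * N + 3 * N ^+ 2 + 1).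
  by rewrite ltr_wpDl// addr_ge0// mulr_ge0// exprn_ge0.
move=> r [E K] [E' K'] r1; rewrite !pair_norm_le/= => /andP[Er Kr] /andP[E'r K'r].
set d := `|_ - _ : W|.
have /andP[/= Ed Kd] : (`|E - E'| <= d) && (`|K - K'| <= d).
  by have := lexx d; rewrite {1}/d pair_norm_le.
have r0 : 0 <= r by rewrite (le_trans _ Er).
have d0 : 0 <= d by rewrite (le_trans _ Ed).
have mul_le (A B : 'M[R]_n) x y : `|A| <= x -> `|B| <= y -> `|A *m B| <= N * (x * y).
  move=> Ax By; rewrite (le_trans (mx_norm_mulmx_le _ _))// -mulrA.
  by rewrite ler_wpM2l// ler_pM.
have -> : cayley_remainder (E, K) - cayley_remainder (E', K')
  = (E - E') *m K + E' *m (K - K') - ((K - K') *m E + K' *m (E - E'))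
    + ((K - K') *m (E *m K) + K' *m ((E - E') *m K) + K' *m (E' *m (K - K'))).
  rewrite /cayley_remainder /commutator/= !(mulmxBl, mulmxBr) !mulmxA.
  move: (E *m K) (E' *m K') (E' *m K) (K *m E) (K' *m E) (K' *m E').
  move: (K *m E *m K) (K' *m E *m K) (K' *m E' *m K') (K' *m E' *m K).
  by move=> *; apply/matrixP => i j; rewrite !mxE; ring.
apply: (@le_trans _ _ (4 * (N * (d * r)) + 3 * (N * (d * (N * (r * r)))))).
  have t1 := mul_le _ _ _ _ Ed Kr.
  have t2 := mul_le _ _ _ _ E'r Kd.
  have t3 := mul_le _ _ _ _ Kd Er.
  have t4 := mul_le _ _ _ _ K'r Ed.
  have t5 := mul_le _ _ _ _ Kd (mul_le _ _ _ _ Er Kr).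
  have t6 := mul_le _ _ _ _ K'r t1.
  have t7 := mul_le _ _ _ _ K'r t2.
  apply: (@le_trans _ _ ((N * (d * r) + N * (r * d))
     + (N * (d * r) + N * (r * d))
     + (N * (d * (N * (r * r))) + N * (r * (N * (d * r)))
        + N * (r * (N * (r * d)))))).
    rewrite (le_trans (ler_normD _ _))// lerD//.
      rewrite (le_trans (ler_normB _ _))// lerD//.
        by rewrite (le_trans (ler_normD _ _))// lerD.
      by rewrite (le_trans (ler_normD _ _))// lerD.
    rewrite (le_trans (ler_normD _ _))// lerD//.
    by rewrite (le_trans (ler_normD _ _))// lerD.
  by rewrite le_eqVlt; apply/orP; left; apply/eqP; ring.
have rr : r * r <= r by rewrite -[leRHS]mulr1 ler_wpM2l.
have : N ^+ 2 * d * (r * r) <= N ^+ 2 * d * r.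
  by rewrite ler_wpM2l// mulr_ge0// exprn_ge0.
have := mulr_ge0 r0 d0.
move=> rd le2; rewrite -subr_ge0.
have -> : (4 * N + 3 * N ^+ 2 + 1) * r * d
    - (4 * (N * (d * r)) + 3 * (N * (d * (N * (r * r)))))
  = 3 * (N ^+ 2 * d * r - N ^+ 2 * d * (r * r)) + r * d by ring.
by rewrite addr_ge0// mulr_ge0// subr_ge0.
Qed.

(** The liberation lemma.  With E and K of order t, the beta-entries of E are
    those of 2 t [M, K0] up to s t, with s below all of them in absolute value,
    and the entries on G of M + E are those of M up to O(t). *)
Theorem liberation_isospectral (G : sgraph n) (M : 'M[R]_n)
    (beta : {set {set 'I_n}}) :
  SSP_liberation G M beta ->
  exists C, SSP (add_edges G beta) C /\ char_poly C = char_poly M.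
Proof.
move=> lib; have [[Msym MG] bN0 bG libP] := lib.
have [K0 [K0skew K0H K0b]] := liberation_direction lib.
set H := add_edges G beta in K0H *.
have HE : edges H = edges G :|: beta := edges_add_edges bG.
have sspH : SSP_wrt H M.
  have [e eb] := set0Pn _ bN0.
  have bGe : beta :\ e \subset edges (compl G).
    by apply: subset_trans bG; rewrite subD1set.
  apply: (@SSP_wrt_sub _ _ (add_edges G (beta :\ e))).
    by rewrite HE edges_add_edges// setUS// subD1set.
  by apply: libP; rewrite ?subD1set// (cardsD1 e beta) eb.
have [g [gsym gK]] := ssp_operator_rinv Msym sspH.
have [dlt dlt0 open_ssp] := SSP_wrt_open Msym sspH.
(* L maps a symmetric Z to a pair (E, K) with E - 2[M, K] = Z. *)
pose L Z : W := (graph_part H (g Z), - 2^-1 *: commutator M (g Z)).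
have L_lin : linear L.
  move=> a X Y; rewrite /L linearP/= graph_part_is_linear commutator_is_linear.
  by rewrite [in LHS]scalerDr [in LHS]scalerA [- 2^-1 * a]mulrC -[in LHS]scalerA.
pose LL := HB.pack_for {linear 'M[R]_n -> W} L
  (GRing.isLinear.Build _ _ _ _ L L_lin).
have [c c0 Lc] := linear_mx_bounded LL.
have [a a0 qlip] := cayley_remainder_lipschitz.
pose u0 : W := (2 *: commutator M K0, K0).
pose S := [set p : 'I_n * 'I_n | [set p.1; p.2] \in beta].
have [s s0 sP] : exists2 s : R, 0 < s & forall p, p \in S -> s < `|u0.1 p.1 p.2|.
  near (0 : R)^'+%classic => s; exists s => //.
  near: s; apply: filter_forall => p.
  case: (boolP (p \in S)) => pS; last by near=> s.
  have u0p : 0 < `|u0.1 p.1 p.2|.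
    rewrite normr_gt0 mxE mulf_eq0 pnatr_eq0/= K0b//.
    by move: pS; rewrite inE.
  by near=> s => _; near: s; exact: nbhs_right_lt.
pose b := `|u0| + s.
have b0 : 0 < b by rewrite ltr_wpDl.
have fixpt : \forall t \near ((0 : R)^'+)%classic,
    exists2 Z, cayley_remainder (t *: u0 + L Z) = Z & `|L Z| <= s * t.
  apply: (perturbed_fixed_point u0 a0 c0 s0 qlip) => [|Y Z|].
  - by rewrite /cayley_remainder /commutator !mulmx0 subrr addr0.
  - by rewrite -(linearB LL) Lc.
  - exact: (linear0 LL).
have Msmall : \forall t \near ((0 : R)^'+)%classic,
    forall p : 'I_n * 'I_n, M p.1 p.2 != 0 -> t * b < `|M p.1 p.2|.
  apply: filter_forall => p; have [M0|M0] := eqVneq (M p.1 p.2) 0; first by near=> t.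
  have Mb : 0 < `|M p.1 p.2| / b by rewrite divr_gt0// normr_gt0.
  by near=> t => _; rewrite -ltr_pdivlMr//; near: t; exact: nbhs_right_lt.
have db0 : 0 < dlt / b by rewrite divr_gt0.
near (0 : R)^'+%classic => t.
have t0 : 0 < t by near: t; exact: nbhs_right_gt.
have [Z qZ LZ] : exists2 Z, cayley_remainder (t *: u0 + L Z) = Z & `|L Z| <= s * t.
  by near: t.
have tM : forall p : 'I_n * 'I_n, M p.1 p.2 != 0 -> t * b < `|M p.1 p.2|.
  by near: t.
have tb : t * b < dlt by rewrite -ltr_pdivlMr//; near: t; exact: nbhs_right_lt.
set u := t *: u0 + L Z in qZ.
have ub : `|u| <= t * b.
  rewrite (le_trans (ler_normD _ _))// normrZ gtr0_norm// /b mulrDr lerD2l.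
  by rewrite (mulrC t).
have trZ (x : R) (Y : 'M[R]_n) : (x *: Y)^T = x *: Y^T by rewrite linearZ.
have trD (X Y : 'M[R]_n) : (X + Y)^T = X^T + Y^T by rewrite linearD.
pose E := u.1; pose K := u.2.
have Eb : `|E| <= t * b by move: ub; rewrite pair_norm_le => /andP[].
have EE : E = t *: (2 *: commutator M K0) + graph_part H (g Z) by [].
have KE : K = t *: K0 - 2^-1 *: commutator M (g Z) by rewrite -scaleNr.
have Kskew : K^T = - K.
  rewrite KE -scaleNr trD !trZ K0skew trmx_commutator Msym gsym.
  by rewrite !scalerN scaleNr opprK opprB addrC.
have Esym : E^T = E.
  by rewrite EE trD !trZ commutator_sym_skew// trmx_graph_part gsym.
(* The fixed point is a value of the remainder, hence symmetric, which is what
   makes the right inverse exact at Z. *)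
have Zsym : Z^T = Z.
  rewrite -qZ /cayley_remainder -/E -/K.
  rewrite trD commutator_sym_skew// !trmx_mul Kskew Esym !mulmxN mulNmx opprK.
  by rewrite mulmxA.
have C_E : E = commutator M K *+ 2 + cayley_remainder u.
  rewrite qZ -[X in _ = _ + X](gK _ Zsym) /ssp_operator EE KE.
  have -> : commutator M (t *: K0 - 2^-1 *: commutator M (g Z))
    = t *: commutator M K0 - 2^-1 *: commutator M (commutator M (g Z)).
    by rewrite linearB/= !linearZ.
  move: (commutator M K0) (graph_part H _) (commutator M (commutator M _)) => x y z.
  by apply/matrixP => i j; rewrite !mxE; field.
exists (M + E); split; last exact: cayley_char_poly Kskew C_E.
split; last first.
  by apply: open_ssp; rewrite addrAC subrr add0r (le_lt_trans Eb).
split=> [|i j ij]; first by rewrite linearD/= Msym Esym.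
rewrite HE inE -MG// mxE.
have [Mij|Mij] := eqVneq (M i j) 0; last first.
  rewrite addr_eq0; apply: contraTneq (tM (i, j) Mij) => /= ->.
  by rewrite normrN -leNgt (le_trans (mx_entry_le_norm _ _ _)).
rewrite Mij add0r/=; have [ijb|ijb] := boolP ([set i; j] \in beta).
  have LZij : `|graph_part H (g Z) i j| <= s * t.
    move: LZ; rewrite pair_norm_le => /andP[+ _].
    exact: le_trans (mx_entry_le_norm _ _ _).
  rewrite EE mxE addr_eq0 [X in X == _]mxE; apply: contraTneq LZij => LZij.
  rewrite -normrN -LZij normrM gtr0_norm// -Order.TotalTheory.ltNge mulrC ltr_pM2l//.
  by apply: (sP (i, j)); rewrite inE.
have ijH : (i == j) || ([set i; j] \in edges H) = false.
  by rewrite (negPf ij) HE inE -MG// Mij eqxx (negPf ijb).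
apply/negbTE; rewrite negbK EE mxE [X in X + _]mxE -K0H [X in t * X]mxE.
by rewrite !mxE ijH !mulr0 addr0.
Unshelve. all: by end_near. Qed.

End Liberation.

Theorem theorem3p7 (R : realType) (m n : nat) (G : sgraph m) (H : sgraph n)
    (A : 'M[R]_m) (B : 'M[R]_n) (lam : R) (k : nat)
    (SSP_A : SSP G A) (SSP_B : SSP H B)
    (common : forall mu : R, (eigenvalue A mu && eigenvalue B mu) = (mu == lam))
    (mult_A : spec A lam = k) (mult_B : spec B lam = 1%N)
    (gen_A : generic (ker_col (A - lam%:M)))
    (gen_B : generic (ker_col (B - lam%:M))) :
  (forall beta : {set 'I_m * 'I_n},
     (exists U : {set 'I_m}, #|U| = k /\
        forall u, u \in U -> #|beta :&: setX [set u] [set: 'I_n]| = 2%N)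
     \/ (exists v : 'I_n, #|beta :&: setX [set: 'I_m] [set v]| = k.+1) ->
     SSP_liberation (disj_union G H) (direct_sum A B) (cross_pairs beta) /\
     exists C : 'M[R]_(m + n),
       SSP (add_edges (disj_union G H) (cross_pairs beta)) C /\
       forall mu : R, spec C mu = (spec A mu + spec B mu)%N) /\
  (k = 1%N -> forall beta : {set 'I_m * 'I_n}, #|beta| = 2%N ->
     SSP_liberation (disj_union G H) (direct_sum A B) (cross_pairs beta)).
Proof.
have k_gt0 : (0 < k)%N.
  have := common lam; rewrite eqxx => /andP[+ _].
  rewrite eigenvalue_root_char root_factor_theorem XsubC_dvd.
    by rewrite -/(spec A lam) mult_A.
  by rewrite monic_neq0 ?char_poly_monic.
have lib := direct_sum_liberation SSP_A SSP_B common mult_A mult_B gen_A gen_B.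
have card_D1 (T : finType) (D : {set T}) p c : #|D| = c.+1 -> (c <= #|D :\ p|)%N.
  move=> cD; rewrite -ltnS -cD (cardsD1 p D).
  by rewrite -[X in (_ <= X)%N]add1n leq_add2r leq_b1.
split=> [beta hb | k1 beta hb]; last first.
  apply: lib => [|p _]; first by rewrite -card_gt0 hb.
  have := card_D1 _ beta p _ hb; rewrite k1 !card_gt0 => /set0Pn[q qb].
  by apply/set0Pn; exists q.1; apply: imset_f.
have libAB : SSP_liberation (disj_union G H) (direct_sum A B) (cross_pairs beta).
  (* Each row of U holds two pairs, so it survives the deletion of one; in the
     column of v, distinct pairs lie in distinct rows. *)
  case: hb => [[U [cardU Ub]]|[v vb]]; apply: lib => [|p _].
  - have [u uU] : exists u, u \in U by apply/set0Pn; rewrite -card_gt0 cardU.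
    have : beta :&: setX [set u] [set: 'I_n] != set0 by rewrite -card_gt0 Ub.
    by case/set0Pn => q /setIP[qb _]; apply/set0Pn; exists q.
  - rewrite -cardU; apply/subset_leq_card/subsetP => u uU.
    have := card_D1 _ _ p _ (Ub u uU); rewrite card_gt0 => /set0Pn[q].
    rewrite !inE andbT => /and3P[qp qb /eqP <-].
    by apply: imset_f; rewrite !inE qp.
  - have : beta :&: setX [set: 'I_m] [set v] != set0 by rewrite -card_gt0 vb.
    by case/set0Pn => q /setIP[qb _]; apply/set0Pn; exists q.
  - apply: leq_trans (card_D1 _ _ p _ vb) _.
    rewrite -(@card_in_imset _ _ fst); last first.
      move=> [u1 v1] [u2 v2]; rewrite !inE /= => /and3P[_ _ /eqP ->].
      by move=> /and3P[_ _ /eqP ->] ->.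
    by apply: subset_leq_card; apply: imsetS; apply: setSD; apply: subsetIl.
split=> //; have [C [sspC chC]] := liberation_isospectral libAB.
exists C; split=> // mu; rewrite /spec chC char_poly_direct_sum mupM//.
- by rewrite monic_neq0 ?char_poly_monic.
- by rewrite monic_neq0 ?char_poly_monic.
Qed.
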